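(* Let $G$ be a finitely generated group with exponential growth which is either virtually solvable or non-amenable. Let $1<p<\infty$, let $q=\max\{p,2\}$, and let $\varphi$ be a uniform embedding of $G$ into some $L^p$-space. Then the compression $\rho$ of $\varphi$ satisfies $$\int_1^{\infty}\left(\frac{\rho(t)}{t}\right)^q\frac{dt}{t}<\infty.$$
   Context: $G$ is equipped with the word metric $d_S(g,h)=|g^{-1}h|_S$ associated to a finite symmetric generating subset $S$. A map $F:X\to Y$ between metric spaces is a uniform embedding if $d_X(x,y)\to\infty \Longleftrightarrow d_Y(F(x),F(y))\to\infty$ (for sequences of pairs of points). Its compression is $\rho(t)=\inf_{d_X(x,y)\geq t}d_Y(F(x),F(y))$. An $L^p$-space is a Banach space of the form $L^p(X,m)$ with $(X,m)$ a measure space. *)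

(* Defs.v *)
(* MathComp / MathComp-Analysis. *)
From HB Require Import structures.
From mathcomp Require Import all_boot all_order all_algebra finmap.
From mathcomp Require Import all_classical all_reals all_analysis.
Set Implicit Arguments.
Unset Strict Implicit.
Unset Printing Implicit Defensive.
Import Order.TTheory GRing.Theory Num.Theory.
Import numFieldNormedType.Exports.
Local Open Scope classical_set_scope.
Local Open Scope ring_scope.

Section Groups.
Variable G : groupType.
Implicit Types (S A H : set G) (g h : G).

Definition is_subgroup H : Prop := group_closed (mem H).

Definition generated A : set G := smallest is_subgroup A.

Definition is_sym_fin_gen S : Prop :=
  [/\ finite_set S, (forall s, S s -> S (s^-1)%g) & generated S = setT].

Definition is_word S g (n : nat) : Prop :=
  exists w : seq G, [/\ size w = n, [set` w] `<=` S & (\prod_(s <- w) s)%g = g].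

(* The default value 0 is only used for g that is not a product of elements of
   S, which cannot happen when S is symmetric and generates G. *)
Definition word_length S g : nat :=
  if pselect (exists n, `[< is_word S g n >]) is left ex_word
  then ex_minn ex_word else 0%N.

Definition word_metric (R : realType) S g h : R :=
  (word_length S (g^-1 * h)%g)%:R.

Definition word_ball S (n : nat) : set G :=
  [set g | (word_length S g <= n)%N].

(* For finite S the balls are finite, so that fset_set is not a dummy.  As
   n |-> #B(n) is submultiplicative, #B(n)^(1/n) converges to its infimum, so
   this says that lim #B(n)^(1/n) > 1. *)
Definition exponential_growth (R : realType) S : Prop :=
  exists2 a : R, 1 < a & forall n, a ^+ n <= #|` fset_set (word_ball S n)|%:R.

Definition derived_subgroup H : set G :=
  generated [set [~ x, y]%g | x in H & y in H].

Definition is_solvable H : Prop :=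
  exists n, iter n derived_subgroup H = [set 1%g].

Definition finite_index H : Prop :=
  finite_set (range (fun g => [set (g * h)%g | h in H])).

Definition virtually_solvable : Prop :=
  exists H, [/\ is_subgroup H, finite_index H & is_solvable H].

(* Invariant mean, as a finitely additive left-invariant probability. *)
Definition amenable (R : realType) : Prop :=
  exists mu : set G -> R,
    [/\ forall A, 0 <= mu A,
        mu setT = 1,
        forall A B, A `&` B = set0 -> mu (A `|` B) = mu A + mu B &
        forall g A, mu [set (g * a)%g | a in A] = mu A].

End Groups.

Section Embeddings.
Variables (R : realType) (X Y : Type).
Variables (dX : X -> X -> R) (dY : Y -> Y -> R).

Definition uniform_embedding (F : X -> Y) : Prop :=
  forall x y : nat -> X,
    (dX (x n) (y n) @[n --> \oo] --> +oo) <->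
    (dY (F (x n)) (F (y n)) @[n --> \oo] --> +oo).

(* The infimum is over a non-empty set whenever dX is unbounded. *)
Definition compression (F : X -> Y) (t : R) : R :=
  inf [set dY (F z.1) (F z.2) | z in [set z : X * X | t <= dX z.1 z.2]].

End Embeddings.

(* The distance of the Banach space L^p(X, m), computed on representatives of
   the classes of functions modulo equality almost everywhere. *)
Definition Lp_dist (R : realType) (d : measure_display) (X : measurableType d)
    (m : {measure set X -> \bar R}) (p : \bar R) (p1 : (1 <= p)%E)
    (f g : LspaceType m p1) : R :=
  fine ('N[m]_p [ (fun x => (f x - g x)%:E) ])%E.

(* Main.v *)
(* Uniform convexity says that |z - x| is short of |y - x| + |z - y| by an amount
   controlled by the second difference z - 2y + x.  Summed over dyadic scales
   2^k along the image X_0, X_1, ... of a path of length n in G, this bounds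
   sum_k 2^(-kq) sum_t |X_(t+2r) - 2 X_(t+r) + X_t|^q, r = 2^k, by a multiple of
   n.  On the other hand, when this second difference is less than half of
   rho(eps r), the point of G at time t+2r is determined by those at times t and
   t+r up to an error eps r.  If this happened at most times t, then endpoints of
   paths of length n could be encoded with fewer than a^n symbols, where a^n is
   the number of points in the ball of radius n.  Hence for at least half of the
   endpoints the second difference is at least rho(eps r)/2 for a fixed positive
   proportion of times, and sum_k (rho(2^k)/2^k)^q is finite. *)
Require Import Defs.
From HB Require Import structures.
From mathcomp Require Import all_boot all_order all_algebra finmap.
From mathcomp Require Import all_classical all_reals all_analysis.
From mathcomp Require Import measurable_realfun.
From mathcomp Require Import ring lra zify.
Set Implicit Arguments.
Unset Strict Implicit.
Unset Printing Implicit Defensive.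
Import Order.TTheory GRing.Theory Num.Theory.
Import numFieldNormedType.Exports.
Local Open Scope classical_set_scope.
Local Open Scope ring_scope.

(** * Scalar inequalities for real powers, up to the two-point inequalities *)

Section RealPowers.
Variable R : realType.
Implicit Types a b c p s t u v x y : R.


(** Young's inequality for x and y^(p-1), with conjugate exponents p and p/(p-1), rearranged as a
    tangent line. *)
Lemma powR_tangent p x y : 1 < p -> 0 <= x -> 0 <= y ->
  y `^ p + p * y `^ (p - 1) * (x - y) <= x `^ p.
Proof.
move=> p1 x0 y0; have p0 : 0 < p by lra.
have pB0 : 0 < p - 1 by lra.
have pN0 : p != 0 by rewrite gt_eqF.
have pBN0 : p - 1 != 0 by rewrite gt_eqF.
have q0 : 0 < p / (p - 1) by rewrite divr_gt0.
have pq : p^-1 + (p / (p - 1))^-1 = 1 by rewrite invf_div; field.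
have := conjugate_powR x0 (powR_ge0 y (p - 1)) p0 q0 pq.
rewrite -powRrM mulrC [(p - 1) * _]mulrC divfK// => h.
have /(ler_wpM2l (ltW p0)) := h.
have -> : p * (x `^ p / p + y `^ p / (p / (p - 1))) = x `^ p + (p - 1) * y `^ p.
  by field; rewrite ?pN0 ?pBN0.
rewrite -(mulr_powRB1 y0 p0); lra.
Qed.

(** Young's inequality for x^r and 1, with exponents 1/r and 1/(1-r): the concave Bernoulli
    bound. *)
Lemma powR_le_affine r x : 0 < r < 1 -> 0 <= x -> x `^ r <= 1 + r * (x - 1).
Proof.
move=> /andP[r0 r1] x0; have rN0 : r != 0 by rewrite gt_eqF.
have rB : 0 < 1 - r by lra.
have rBN0 : 1 - r != 0 by rewrite gt_eqF.
have := @conjugate_powR _ (x `^ r) 1 r^-1 (1 - r)^-1 (powR_ge0 _ _) ler01.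
rewrite !invr_gt0 !invrK => /(_ r0 rB); rewrite subrKC => /(_ erefl).
by rewrite mulr1 -powRrM mulfV// powRr1// powR1; lra.
Qed.

Lemma powR_half_convex p x y : 1 <= p -> 0 <= x -> 0 <= y ->
  ((x + y) / 2) `^ p <= (x `^ p + y `^ p) / 2.
Proof.
rewrite le_eqVlt => /predU1P[<-|p1] x0 y0.
  by rewrite !powRr1// divr_ge0// addr_ge0.
have m0 : 0 <= (x + y) / 2 by rewrite divr_ge0// addr_ge0.
have := powR_tangent p1 x0 m0; have := powR_tangent p1 y0 m0.
set P := _ `^ (p - 1); lra.
Qed.

(** In x^s = x * x^(s-1) and y^s = y * y^(s-1) the second factors are at most (x+y)^(s-1). *)
Lemma powR_superadd s x y : 1 <= s -> 0 <= x -> 0 <= y ->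
  x `^ s + y `^ s <= (x + y) `^ s.
Proof.
move=> s1 x0 y0; have s0 : 0 < s by lra.
rewrite -!(@mulr_powRB1 _ _ s) ?addr_ge0// mulrDl.
by apply: lerD; apply: ler_wpM2l => //; apply: ge0_ler_powR;
  rewrite ?nnegrE ?subr_ge0 ?lerDl ?lerDr ?(addr_ge0 x0 y0).
Qed.

Lemma powR_norm_sqr s x : `|x| `^ (2 * s) = (x ^+ 2) `^ s.
Proof. by rewrite powRrM powR_mulrn// real_normK ?num_real. Qed.

(** Superadditivity of the power p/2 on squares, then the parallelogram identity, then convexity of
    the same power. *)
Lemma clarkson_real p u v : 2 <= p ->
  `|u| `^ p + `|v| `^ p <= (`|u + v| `^ p + `|u - v| `^ p) / 2.
Proof.
move=> p2; have -> : p = 2 * (p / 2) by field.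
rewrite !powR_norm_sqr; set s := p / 2.
have s1 : 1 <= s by rewrite /s; lra.
apply: (le_trans (powR_superadd s1 (sqr_ge0 _) (sqr_ge0 _))).
have -> : u ^+ 2 + v ^+ 2 = ((u + v) ^+ 2 + (u - v) ^+ 2) / 2 by field.
by rewrite powR_half_convex ?sqr_ge0.
Qed.

(** A quarter of the coefficient of x^2 in the expansion of ((1+x)^p + (1-x)^p)/2 at 0. *)
Definition two_point_const p := p * (p - 1) / 8.

(* Tangent lines at 1 + x/2 and 1 - x/2 gain the quadratic term, since the
   slopes there differ by at least a multiple of x. *)
Lemma two_point_unit p x : 1 < p < 2 -> 0 <= x <= 1 ->
  1 + two_point_const p * x ^+ 2 <= ((1 + x) `^ p + (1 - x) `^ p) / 2.
Proof.
move=> /andP[p1 p2] /andP[x0 x1]; rewrite /two_point_const.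
have h1 : 0 <= 1 + x / 2 by lra.
have h2 : 0 <= 1 - x / 2 by lra.
have t1 := @powR_tangent p (1 + x) (1 + x / 2) p1 (addr_ge0 ler01 x0) h1.
have t2 : _ <= (1 - x) `^ p := @powR_tangent p (1 - x) (1 - x / 2) p1 ltac:(lra) h2.
have /(_ (ltW p1)) := @powR_half_convex p _ _ _ h1 h2.
have -> : (1 + x / 2 + (1 - x / 2)) / 2 = 1 by field.
rewrite powR1 => h3.
have a1 : (1 - x / 2) `^ (p - 1) <= 1 + (p - 1) * (- (x / 2)).
  have := @powR_le_affine (p - 1) (1 - x / 2) ltac:(lra) h2; lra.
have a2 : 1 <= (1 + x / 2) `^ (p - 1).
  rewrite -[leLHS](powRr0 (1 + x / 2)); apply: ler_powR; lra.
move: t1 t2 a1 a2 h3.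
set A := _ `^ (p - 1); set B := _ `^ (p - 1).
set C := _ `^ p; set D := _ `^ p; set E := _ `^ p; set F := _ `^ p.
move=> t1 t2 a1 a2 h3.
have AB : (p - 1) * (x / 2) <= A - B by lra.
have px : 0 <= p * (x / 2) by rewrite mulr_ge0//; lra.
have := ler_wpM2l px AB.
have -> : x ^+ 2 = x * x by [].
lra.
Qed.

(** Symmetry and homogeneity reduce this to u = 1 and 0 <= v <= 1, which is [two_point_unit]. *)
Lemma two_point p u v : 1 < p < 2 ->
  (u ^+ 2 + two_point_const p * v ^+ 2) `^ (p / 2) <=
  (`|u + v| `^ p + `|u - v| `^ p) / 2.
Proof.
move=> /[dup] p12 /andP[p1 p2].
have c0 : 0 < two_point_const p.
  by rewrite /two_point_const !mulr_gt0//; lra.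
have c1 : two_point_const p <= 1 by rewrite /two_point_const; nra.
have := two_point_unit p12.
move: (two_point_const p) c0 c1 => c c0 c1 two_point1.
(* Exchanging [u] and [v] when |u| < |v| keeps the right side and can only enlarge the left one,
   because c <= 1. *)
wlog uv : u v / `|v| <= `|u|.
  move=> h; have [|/ltW vu] := leP `|v| `|u|; first exact: h.
  apply: le_trans (_ : (v ^+ 2 + c * u ^+ 2) `^ (p / 2) <= _).
    have hsq : u ^+ 2 <= v ^+ 2.
      by rewrite -ler_sqr ?nnegrE// !real_normK ?num_real in vu.
    apply: ge0_ler_powR; rewrite ?nnegrE; first lra.
    - by rewrite addr_ge0 ?sqr_ge0// mulr_ge0 ?sqr_ge0// ltW.
    - by rewrite addr_ge0 ?sqr_ge0// mulr_ge0 ?sqr_ge0// ltW.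
    have : 0 <= (1 - c) * (v ^+ 2 - u ^+ 2) by rewrite mulr_ge0 ?subr_ge0.
    lra.
  by have := h _ _ vu; rewrite (addrC v u) (distrC v u).
wlog u0 : u v uv / 0 <= u.
  move=> h; have [|/ltW u0] := leP 0 u; first exact: h.
  rewrite -(normrN (u + v)) -(normrN (u - v)) !opprD -(sqrrN u) -(sqrrN v).
  by apply: h; rewrite ?normrN ?oppr_ge0.
wlog v0 : v uv / 0 <= v.
  move=> h; have [|/ltW v0] := leP 0 v; first exact: h.
  have -> : u + v = u - (- v) by rewrite opprK.
  rewrite -(sqrrN v) [X in _ <= X / 2]addrC.
  by apply: h; rewrite ?normrN ?oppr_ge0.
rewrite !ger0_norm// in uv.
move: u0; rewrite le_eqVlt => /predU1P[u0|u0].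
  have -> : v = 0 by lra.
  by rewrite -u0 expr0n/= mulr0 addr0 subr0 normr0 !powR0 ?addr0 ?mul0r//; lra.
have vu : 0 <= v / u <= 1 by rewrite divr_ge0 ?(ltW u0)// ler_pdivrMr ?mul1r.
have -> : u ^+ 2 + c * v ^+ 2 = u ^+ 2 * (1 + c * (v / u) ^+ 2).
  by field; rewrite gt_eqF.
have -> : u + v = u * (1 + v / u) by field; rewrite gt_eqF.
have -> : u - v = u * (1 - v / u) by field; rewrite gt_eqF.
move: vu; set x := v / u => /[dup] x01 /andP[x0 x1].
rewrite !ger0_norm ?mulr_ge0 ?(ltW u0)//; [|lra|lra].
have cx : 0 <= c * x ^+ 2 by rewrite mulr_ge0 ?sqr_ge0 ?(ltW c0).
have x1B : 0 <= 1 - x by lra.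
have x1D : 0 <= 1 + x by lra.
rewrite (powRM _ (sqr_ge0 u)); last lra.
rewrite -powR_norm_sqr (ger0_norm (ltW u0)) !(powRM _ (ltW u0))//.
have -> : 2 * (p / 2) = p by field.
rewrite -mulrDr -mulrA ler_wpM2l ?powR_ge0//.
apply: le_trans (two_point1 _ x01).
(* Bernoulli: (1 + c x^2)^(p/2) <= 1 + (p/2) c x^2, and p/2 <= 1. *)
have /le_trans := @powR_le_affine (p / 2) (1 + c * x ^+ 2) ltac:(lra) ltac:(lra).
apply; rewrite addrAC subrr add0r lerD2l.
by rewrite ler_piMl//; lra.
Qed.

(* Hoelder in the dual form: the linear functional (al, be) touches the concave
   function (u^p, v^p) |-> (u^2 + c v^2)^(p/2) at the point (U^p, V^p). *)
Lemma two_point_dual p c N U V u v : 1 < p < 2 -> 0 < c -> 0 < N ->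
    0 <= U -> 0 <= V -> U ^+ 2 + c * V ^+ 2 = N ^+ 2 ->
  (U / N) `^ (2 - p) * `|u| `^ p + c * (V / N) `^ (2 - p) * `|v| `^ p <=
  (u ^+ 2 + c * v ^+ 2) `^ (p / 2).
Proof.
move=> /andP[p1 p2] c0 N0 U0 V0 UVN.
have pN0 : p != 0 by rewrite gt_eqF//; lra.
have pBN0 : 2 - p != 0 by rewrite gt_eqF//; lra.
have cN0 : c != 0 by rewrite gt_eqF.
have UN0 : 0 <= U / N by rewrite divr_ge0// ltW.
have VN0 : 0 <= V / N by rewrite divr_ge0// ltW.
have P0 : 0 < 2 / p by rewrite divr_gt0//; lra.
have Q0 : 0 < 2 / (2 - p) by rewrite divr_gt0//; lra.
have PQ : (2 / p)^-1 + (2 / (2 - p))^-1 = 1 by rewrite !invf_div; field.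
have cc : c = c `^ (p / 2) * c `^ ((2 - p) / 2).
  by rewrite -powRD ?cN0 ?implybT// (_ : _ + _ = 1) ?powRr1 ?ltW//; field.
have := @hoelder2 _ (`|u| `^ p) (c `^ (p / 2) * `|v| `^ p) ((U / N) `^ (2 - p))
  (c `^ ((2 - p) / 2) * (V / N) `^ (2 - p)) (2 / p) (2 / (2 - p)).
rewrite !mulr_ge0 ?powR_ge0// => /(_ isT isT isT isT P0 Q0 PQ).
rewrite !(@powRM _ (c `^ _)) ?powR_ge0// -!powRrM.
have -> : p * (2 / p) = 2 * 1 by field.
have -> : p / 2 * (2 / p) = 1 by field.
have -> : (2 - p) * (2 / (2 - p)) = 2 * 1 by field.
have -> : (2 - p) / 2 * (2 / (2 - p)) = 1 by field.
rewrite -{1 2}(ger0_norm UN0) -{1 2}(ger0_norm VN0) !powR_norm_sqr.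
rewrite !powRr1 ?sqr_ge0 ?(ltW c0)// (ger0_norm UN0) (ger0_norm VN0).
have -> : (U / N) ^+ 2 + c * (V / N) ^+ 2 = (U ^+ 2 + c * V ^+ 2) / N ^+ 2.
  by field; rewrite gt_eqF.
rewrite UVN divff ?expf_neq0 ?gt_eqF// powR1 mulr1 invf_div.
apply: le_trans; rewrite [in leLHS]cc [leLHS]addrC (mulrC (`|u| `^ _)).
by rewrite [leRHS]addrC lerD2r; lra.
Qed.

End RealPowers.

(** * Uniform convexity of the L^p norm, with power max(p, 2) *)

Definition convexity_const (R : realType) (p : R) : R :=
  if 2 <= p then 1 else two_point_const p.

Lemma convexity_const_gt0 (R : realType) (p : R) : 1 < p -> 0 < convexity_const p.
Proof.
move=> p1; rewrite /convexity_const; case: ifPn => //.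
by rewrite -ltNge => p2; rewrite /two_point_const !mulr_gt0//; lra.
Qed.

Section LpConvexity.
Variables (R : realType) (d : measure_display) (X : measurableType d).
Variables (m : {measure set X -> \bar R}) (p : R) (p1 : (1 <= p%:E)%E).
Implicit Types f g : LfunType m p1.

Definition Lp_norm f : R := fine ('N[m]_p%:E[EFin \o f])%E.

Lemma Lp_norm_ge0 f : 0 <= Lp_norm f.
Proof. by rewrite fine_ge0 ?Lnorm_ge0. Qed.

Lemma Lp_normB f g : Lp_norm (f - g) <= Lp_norm f + Lp_norm g.
Proof.
have := ler_LnormD f (- g); rewrite -/(Lp_norm _) => /le_trans; apply.
by rewrite lerD2l -/(Lp_norm _) /Lp_norm -(LnormrN g).
Qed.

Lemma Lp_norm2 f : Lp_norm (f *+ 2) = 2 * Lp_norm f.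
Proof. by rewrite /Lp_norm Lnormr_natmul mulr_natl. Qed.

Let p_ge1 : 1 <= p. Proof. by rewrite -lee_fin. Qed.

Let p_gt0 : 0 < p. Proof. exact: lt_le_trans ltr01 p_ge1. Qed.

Lemma integrable_normr_powR f :
  m.-integrable setT (EFin \o (fun x => `|f x| `^ p)).
Proof. exact: (Lfun_integrable p_ge1 (LfunP f)). Qed.

Lemma Lp_norm_powR f : Lp_norm f `^ p = \int[m]_x (`|f x| `^ p).
Proof.
rewrite /Rintegral -fine_poweR powR_Lnorm ?gt_eqF//.
Qed.

(** Both sides are linear in p-th powers, so the scalar inequality can be integrated. *)
Lemma Lp_norm_pointwise f g (a b : R) :
    (forall u v : R, a * `|u| `^ p + b * `|v| `^ p <=
                     (`|u + v| `^ p + `|u - v| `^ p) / 2) ->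
  a * Lp_norm f `^ p + b * Lp_norm g `^ p <=
  (Lp_norm (f + g) `^ p + Lp_norm (f - g) `^ p) / 2.
Proof.
move=> h; rewrite !Lp_norm_powR [leRHS]mulrC.
have iZ c (k : LfunType m p1) :
    m.-integrable setT (EFin \o (fun x => c * `|k x| `^ p)).
  exact: (integrableZl measurableT c (integrable_normr_powR k)).
have iD c (k : LfunType m p1) c' (k' : LfunType m p1) : m.-integrable setT
    (EFin \o (fun x => c * `|k x| `^ p + c' * `|k' x| `^ p)).
  exact: (integrableD measurableT (iZ c k) (iZ c' k')).
have intD c (k : LfunType m p1) c' (k' : LfunType m p1) :
    c * (\int[m]_x (`|k x| `^ p)) + c' * (\int[m]_x (`|k' x| `^ p)) =
    \int[m]_x (c * `|k x| `^ p + c' * `|k' x| `^ p).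
  rewrite RintegralD//.
  by rewrite !RintegralZl//; exact: integrable_normr_powR.
rewrite mulrDr !intD; apply: le_Rintegral => // x _.
by have := h (f x) (g x); rewrite mulrDl ![_ * 2^-1]mulrC.
Qed.

(** For p >= 2 the scalar Clarkson inequality is integrated. For p < 2 the scalar inequality is not
    linear in p-th powers; it is first replaced by its linear minorant at the norms [U], [V]. This
    bounds N^p, and convexity of the power 2/p then passes from exponent p to exponent 2. *)
Lemma Lp_norm_convex f g : 1 < p ->
  Lp_norm f `^ Num.max p 2 + convexity_const p * Lp_norm g `^ Num.max p 2 <=
  (Lp_norm (f + g) `^ Num.max p 2 + Lp_norm (f - g) `^ Num.max p 2) / 2.
Proof.
move=> p1'; have c0 := convexity_const_gt0 p1'.
move: c0; rewrite /convexity_const; case: ifPn => p2 c0.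
  rewrite (max_idPl p2) -{1}[_ `^ p]mul1r; apply: Lp_norm_pointwise => u v.
  by rewrite !mul1r clarkson_real.
rewrite -ltNge in p2; rewrite (max_idPr (ltW p2)).
have p12 : 1 < p < 2 by rewrite p1'.
have tp := two_point _ _ p12.
move: (two_point_const p) c0 tp => c c0 tp.
rewrite !powR_mulrn ?Lp_norm_ge0//.
set U := Lp_norm f; set V := Lp_norm g; set A := Lp_norm _; set B := Lp_norm _.
have U0 : 0 <= U by exact: Lp_norm_ge0.
have V0 : 0 <= V by exact: Lp_norm_ge0.
have A0 : 0 <= A by exact: Lp_norm_ge0.
have B0 : 0 <= B by exact: Lp_norm_ge0.
have S0 : 0 <= U ^+ 2 + c * V ^+ 2.
  by rewrite addr_ge0 ?sqr_ge0// mulr_ge0 ?sqr_ge0// ltW.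
pose N := Num.sqrt (U ^+ 2 + c * V ^+ 2).
have N2 : U ^+ 2 + c * V ^+ 2 = N ^+ 2 by rewrite sqr_sqrtr.
have := sqrtr_ge0 (U ^+ 2 + c * V ^+ 2); rewrite -/N le_eqVlt.
case/predU1P => [N0|N0].
  by rewrite N2 -N0 expr0n divr_ge0 ?addr_ge0 ?sqr_ge0.
have NM : N `^ p <= (A `^ p + B `^ p) / 2.
  (* These are the coefficients of the functional in [two_point_dual]; it touches at ([U], [V]), so
     the integrated left side equals N^p. *)
  have := @Lp_norm_pointwise f g ((U / N) `^ (2 - p)) (c * (V / N) `^ (2 - p)).
  rewrite -/U -/V -/A -/B => h; apply: le_trans (h _); last first.
    by move=> u v; apply: le_trans (tp u v); exact: two_point_dual.
  have weight W : 0 <= W -> (W / N) `^ (2 - p) * W `^ p = N `^ p * (W / N) ^+ 2.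
    move=> W0; have WN0 : 0 <= W / N by rewrite divr_ge0 // ltW.
    have {2}-> : W = N * (W / N) by rewrite mulrCA divff ?mulr1 ?gt_eqF.
    rewrite (powRM _ (ltW N0) WN0) mulrCA -powRD ?subrK ?powR_mulrn//.
    by rewrite (_ : 2 == 0 = false) ?pnatr_eq0.
  rewrite -mulrA !weight// (mulrCA c) -mulrDr ler_peMr ?powR_ge0//.
  have -> : (U / N) ^+ 2 + c * (V / N) ^+ 2 = (U ^+ 2 + c * V ^+ 2) / N ^+ 2.
    by field; rewrite gt_eqF.
  by rewrite N2 divff// expf_neq0// gt_eqF.
have pow W : 0 <= W -> W ^+ 2 = (W `^ p) `^ (2 / p).
  by move=> W0; rewrite -powRrM (mulrC p) divfK ?gt_eqF// powR_mulrn.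
rewrite N2 !pow ?(ltW N0)//.
have s1 : 1 <= 2 / p by rewrite ler_pdivlMr ?mul1r ?ltW.
apply: le_trans (powR_half_convex s1 (powR_ge0 _ _) (powR_ge0 _ _)).
apply: ge0_ler_powR; rewrite ?nnegrE ?powR_ge0//; first by rewrite divr_ge0 ?ltW.
by rewrite divr_ge0 ?addr_ge0 ?powR_ge0.
Qed.

End LpConvexity.

(** * Second differences along a path that becomes constant *)

Section DyadicPath.
Variables (R : realType) (V : zmodType) (N : V -> R) (q c : R).
Hypothesis q_gt0 : 0 < q.
Hypothesis N_ge0 : forall x, 0 <= N x.
Hypothesis N_mul2 : forall x, N (x *+ 2) = 2 * N x.
Hypothesis N_convex : forall x y,
  N x `^ q + c * N y `^ q <= (N (x + y) `^ q + N (x - y) `^ q) / 2.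

Variables (path : nat -> V) (n : nat).
Hypothesis path_stops : forall t, (n <= t)%N -> path t = path n.

Definition second_diff r t := path (t + r + r) - path (t + r) - (path (t + r) - path t).

Definition moment r : R := \sum_(t < n) N (path (t + r)%N - path t) `^ q.

Definition bending r : R := \sum_(t < n) N (second_diff r t) `^ q.

Let N0 : N 0 = 0.
Proof. by have := N_mul2 0; rewrite mul0rn; lra. Qed.

(** Increments starting at time [n] or later vanish, so [moment r] may be summed up to n + r; the
    left side omits its first [r] terms. *)
Lemma moment_shift r :
  \sum_(t < n) N (path (t + r + r)%N - path (t + r)%N) `^ q <= moment r.
Proof.
pose F t := N (path (t + r)%N - path t) `^ q.
have F_ge0 t : 0 <= F t by exact: powR_ge0.
have -> : moment r = \sum_(0 <= t < n + r) F t.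
  rewrite (big_cat_nat (n := n)) ?leq_addr//= [X in _ = _ + X]big_nat_cond.
  rewrite [X in _ = _ + X]big1 ?addr0 ?big_mkord// => t /andP[/andP[nt _] _].
  rewrite /F (path_stops nt) (path_stops (leq_trans nt (leq_addr _ _))).
  by rewrite subrr N0 powR0 ?gt_eqF.
rewrite [leRHS](big_cat_nat (n := r)) ?leq_addl//=.
have -> : \sum_(r <= t < n + r) F t = \sum_(t < n) F (t + r)%N.
  by rewrite -{1}(add0n r) big_addn addnK big_mkord.
by rewrite lerDr sumr_ge0.
Qed.

Lemma moment_double r : moment (r + r) + c * bending r <= 2 `^ q * moment r.
Proof.
have twoq : 0 <= 2 `^ q :> R by exact: powR_ge0.
apply: (@le_trans _ _ (2 `^ q * (\sum_(t < n)
    N (path (t + r + r)%N - path (t + r)%N) `^ q + moment r) / 2)); last first.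
  by rewrite -mulrA ler_wpM2l// ler_pdivrMr// mulr_natr mulr2n lerD2r moment_shift.
rewrite /moment /bending -big_split/= !mulr_sumr mulr_suml -big_split/=.
apply: ler_sum => t _; rewrite addnA.
(* With a, b the two consecutive increments of length [r], convexity is used at a + b and a - b,
   whose sum and difference are 2a and 2b. *)
have := N_convex (path (t + r + r)%N - path t) (second_diff r t).
set x := path (t + r + r)%N; set y := path (t + r)%N; set z := path t.
have -> : second_diff r t = (x - y) - (y - z) by [].
have -> : x - z = (x - y) + (y - z) by rewrite addrA subrK.
move: (x - y) (y - z) => a b.
have -> : a + b + (a - b) = a *+ 2 by rewrite addrACA subrr addr0 mulr2n.
have -> : a + b - (a - b) = b *+ 2.
  by rewrite opprB (addrC b) addrACA subrr add0r mulr2n.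
by rewrite !N_mul2 !powRM// -mulrDr.
Qed.

(** The normalised moments [moment (2 ^ k)] / 2^(kq) decrease in [k], each by at least [c] times one
    term of the sum. The induction keeps the last moment on the left so that the sum telescopes. *)
Lemma dyadic_bending_le k :
  c * \sum_(i < k) bending (2 ^ i) / (2 ^ i.+1)%:R `^ q <= moment 1.
Proof.
suff : moment (2 ^ k) / (2 ^ k)%:R `^ q +
    c * \sum_(i < k) bending (2 ^ i) / (2 ^ i.+1)%:R `^ q <= moment 1.
  apply: le_trans; rewrite lerDr divr_ge0 ?powR_ge0//.
  by rewrite sumr_ge0// => t _; exact: powR_ge0.
elim: k => [|k IHk]; first by rewrite big_ord0 mulr0 addr0 expn0 powR1 divr1.
apply: le_trans IHk; rewrite big_ord_recr/= mulrDr addrCA addrC lerD2r.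
have pk : 0 < (2 ^ k)%:R `^ q :> R by rewrite powR_gt0// ltr0n expn_gt0.
have p2 : 0 < 2 `^ q :> R by rewrite powR_gt0.
rewrite expnS natrM powRM// mulrA -mulrDl mul2n -addnn.
rewrite ler_pdivrMr ?mulr_gt0// [leRHS]mulrCA divfK ?gt_eqF//.
exact: moment_double.
Qed.

End DyadicPath.

(** * Words, balls and geodesic paths in the group *)

Section Words.
Variables (G : groupType) (S : set G).
Implicit Types (g h : G) (w : seq G).

Lemma is_wordM g h k l :
  is_word S g k -> is_word S h l -> is_word S (g * h)%g (k + l).
Proof.
move=> [u [<- uS <-]] [v [<- vS <-]]; exists (u ++ v); split.
- by rewrite size_cat.
- by move=> x /=; rewrite mem_cat => /orP[/uS|/vS].
- by rewrite big_cat.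
Qed.

Lemma word_length_le g k : is_word S g k -> (word_length S g <= k)%N.
Proof.
move=> gk; rewrite /word_length; case: pselect => [ex|//].
by case: ex_minnP => l _; apply; apply/asboolP.
Qed.

Hypothesis hS : is_sym_fin_gen S.

Lemma is_wordV g k : is_word S g k -> is_word S (g^-1)%g k.
Proof.
have [_ symS _] := hS; move=> [w [<- + <-]] {g k}; elim: w => [|x w IHw] wS.
  by exists [::]; split => //; rewrite !big_nil invg1.
have [|v [vw vS vE]] := IHw.
  by move=> y yw; apply: wS; rewrite /= inE [_ \in _]yw orbT.
exists (rcons v (x^-1)%g); split; first by rewrite size_rcons vw.
  move=> y /=; rewrite mem_rcons inE => /orP[/eqP->|/vS//].
  by apply/symS/wS; rewrite /= inE eqxx.
by rewrite -cats1 big_cat big_seq1 big_cons invgM vE.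
Qed.

Lemma ex_word g : exists k, is_word S g k.
Proof.
have [_ _ genS] := hS.
have : generated S g by rewrite genS.
move/(_ [set x | exists k, is_word S x k]); apply; split; last first.
  move=> s Ss; exists 1%N, [:: s]; split => //; last by rewrite big_seq1.
  by move=> x /=; rewrite inE => /eqP->.
split; first by rewrite inE; exists 0%N, [::]; split => //; rewrite big_nil.
move=> x y; rewrite !inE => -[k xk] [l yl].
by exists (k + l)%N; apply: is_wordM xk (is_wordV yl).
Qed.

Lemma is_word_length g : is_word S g (word_length S g).
Proof.
rewrite /word_length; case: pselect => [ex|]; first by case: ex_minnP => l /asboolP.
by have [k gk] := ex_word g; case; exists k; apply/asboolP.
Qed.

Lemma word_length1 : word_length S 1%g = 0%N.
Proof.
apply/eqP; rewrite -leqn0; apply: word_length_le.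
by exists [::]; split => //; rewrite big_nil.
Qed.

(* The padding by 1 makes this list all products of at most k letters. *)
Definition ball_seq k : seq G :=
  iter k (fun l => [seq (x * s)%g | x <- l, s <- 1%g :: fset_set S]) [:: 1%g].

Lemma size_ball_seq k : size (ball_seq k) = ((size (fset_set S)).+1 ^ k)%N.
Proof.
elim: k => [//|k IHk].
by rewrite /ball_seq iterS size_allpairs -/(ball_seq k) IHk expnSr.
Qed.

Lemma ball_seqS k g : g \in ball_seq k -> g \in ball_seq k.+1.
Proof.
by move=> gk; apply/allpairsP; exists (g, 1%g); rewrite inE eqxx mulg1.
Qed.

Lemma mem_ball_seq g k : (word_length S g <= k)%N -> g \in ball_seq k.
Proof.
have [finS _ _] := hS.
have [w [wl wS wg]] := is_word_length g; rewrite -wl -wg {wl wg g}.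
elim/last_ind: w k wS => [|w x IHw] k wS.
  move=> _; rewrite big_nil; elim: k => [|k]; first by rewrite inE.
  exact: ball_seqS.
rewrite size_rcons; case: k => [//|k]; rewrite ltnS => wk.
rewrite -cats1 big_cat big_seq1; apply/allpairsP.
exists (\prod_(s <- w) s, x)%g; split => //=.
  by apply: IHw => // y yw; apply: wS; rewrite /= mem_rcons inE [_ \in _]yw orbT.
rewrite inE in_fset_set// mem_set ?orbT//.
by apply: wS; rewrite /= mem_rcons inE eqxx.
Qed.

Lemma finite_word_ball k : finite_set (word_ball S k).
Proof.
apply: (@sub_finite_set _ _ [set` ball_seq k]); last exact: finite_seq.
by move=> g /=; exact: mem_ball_seq.
Qed.

(** The path runs through the prefixes of a shortest word for [g] and then stays at [g]; its
    increments are products of subwords. *)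
Lemma word_path g k : (word_length S g <= k)%N ->
  exists path : nat -> G, [/\ path 0%N = 1%g, forall t, (k <= t)%N -> path t = g
    & forall t r, (word_length S ((path t)^-1 * path (t + r)%N)%g <= r)%N].
Proof.
have [w [wl wS wg]] := is_word_length g; rewrite -wl => wk.
exists (fun t => \prod_(s <- take t w) s)%g; split.
- by rewrite take0 big_nil.
- by move=> t kt; rewrite take_oversize// (leq_trans wk).
move=> t r; rewrite takeD big_cat mulKg.
have := @word_length_le (\prod_(s <- take r (drop t w)) s)%g
  (size (take r (drop t w))).
move=> /(_ _)/leq_trans; apply; last by rewrite size_take_min geq_minl.
exists (take r (drop t w)); split => // x /= xw; apply: wS.
exact: (mem_drop (mem_take xw)).
Qed.

End Words.

(** * Weighted counting of trajectories with restricted successors *)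

Section WeightedPaths.
Variables (R : realFieldType) (T : eqType) (I : finType) (u : nat -> I -> T).
Variables (next : T -> seq T) (w : T -> T -> T -> R) (c : R) (m : nat).
Hypothesis u_next : forall t i, u t.+1 i \in next (u t i).
Hypothesis u_inj : injective (u m.+1).
Hypothesis w_ge0 : forall x y z, 0 <= w x y z.
Hypothesis w_sum : forall x y, \sum_(z <- next y) w x y z <= c.

Definition path_weight k i := \prod_(k <= j < m) w (u j i) (u j.+1 i) (u j.+2 i).

Lemma path_weight_ge0 k i : 0 <= path_weight k i.
Proof. by rewrite prodr_ge0. Qed.

(** Only an inequality, since [s] may contain an element several times. *)
Lemma sum_fibers (A : pred I) (v : I -> T) (s : seq T) (F : I -> R) :
    (forall i, 0 <= F i) -> (forall i, A i -> v i \in s) ->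
  \sum_(i | A i) F i <= \sum_(z <- s) \sum_(i | A i && (v i == z)) F i.
Proof.
move=> F0 vs.
have -> : \sum_(z <- s) \sum_(i | A i && (v i == z)) F i =
    \sum_(i | A i) \sum_(z <- s) (if v i == z then F i else 0).
  rewrite exchange_big/=; apply: eq_bigr => z _.
  by rewrite -big_mkcondr.
apply: ler_sum => i Ai; rewrite (big_rem _ (vs i Ai))/= eqxx lerDl.
by rewrite sumr_ge0// => z _; case: ifP.
Qed.

(** Induction on the number [l] of remaining steps, with the two latest positions fixed. Splitting
    by the next position costs a factor [c]; at the end injectivity leaves at most one
    trajectory. *)
Lemma path_weight_fiber l k (A : pred I) x y : (k + l = m)%N ->
    (forall i, A i -> u k i = x /\ u k.+1 i = y) ->
  \sum_(i | A i) path_weight k i <= c ^+ l.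
Proof.
have c0 (z : T) : 0 <= c by rewrite (le_trans _ (w_sum z z)) ?sumr_ge0.
elim: l k A x y => [|l IHl] k A x y klm Axy.
  rewrite expr0 (_ : \sum_(i | _) _ = #|A|%:R).
    rewrite addn0 in klm; rewrite lern1; apply/card_le1P => i Ai j.
    rewrite !inE; apply/idP/eqP => [Aj|->//].
    by apply: u_inj; rewrite -klm (Axy i Ai).2 (Axy j Aj).2.
  under eq_bigr do rewrite /path_weight big_geq -?klm ?addn0//.
  by rewrite sumr_const.
have km : (k < m)%N by rewrite -klm addnS ltnS leq_addr.
apply: (@le_trans _ _ (\sum_(z <- next y) w x y z * c ^+ l)); last first.
  by rewrite -mulr_suml exprS ler_wpM2r ?exprn_ge0 ?(c0 x).
apply: le_trans (_ : \sum_(z <- next y)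
    \sum_(i | A i && (u k.+2 i == z)) path_weight k i <= _).
  apply: sum_fibers => [i|i Ai]; first exact: path_weight_ge0.
  by rewrite -(Axy i Ai).2.
apply: ler_sum => z _.
rewrite (eq_bigr (fun i => w x y z * path_weight k.+1 i)); last first.
  move=> i /andP[/Axy[xi yi] /eqP zi].
  by rewrite /path_weight big_ltn// xi yi zi.
rewrite -mulr_sumr ler_wpM2l//; apply: (IHl _ _ y z); first by rewrite addSnnS.
by move=> i /andP[/Axy[_ ->] /eqP->].
Qed.

(** The first two positions, which the weights do not control, are chosen in at most [size s * D]
    ways; [path_weight_fiber] treats the rest. *)
Lemma path_weight_total (s : seq T) (D : nat) :
    (forall i, u 0 i \in s) -> (forall x, (size (next x) <= D)%N) ->
  \sum_i path_weight 0 i <= (size s * D)%:R * c ^+ m.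
Proof.
move=> us nextD.
apply: (le_trans (sum_fibers (path_weight_ge0 0) (fun i _ => us i))).
apply: (@le_trans _ _ (\sum_(x <- s) D%:R * c ^+ m)); last first.
  by rewrite big_const_seq count_predT iter_addr_0 natrM -mulrA !mulr_natl.
apply: ler_sum => x _.
apply: (@le_trans _ _ (\sum_(y <- next x) c ^+ m)); last first.
  rewrite big_const_seq count_predT iter_addr_0 -[leLHS]mulr_natl ler_wpM2r ?ler_nat//.
  by rewrite exprn_ge0// (le_trans _ (w_sum x x)) ?sumr_ge0.
apply: le_trans (_ : \sum_(y <- next x)
    \sum_(i | (u 0 i == x) && (u 1 i == y)) path_weight 0 i <= _).
  apply: sum_fibers => [i|i /eqP <-//]; exact: path_weight_ge0.
apply: ler_sum => y _; apply: (path_weight_fiber (x := x) (y := y)) => //.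
by move=> i /andP[/eqP + /eqP].
Qed.

End WeightedPaths.

(** Times are sorted by their residue modulo [r], so that each class is a progression along which
    triples spaced by [r] overlap. *)
Lemma sum_nat_mul_grid (r M : nat) (F : nat -> nat) :
  (\sum_(t < r * M) F t = \sum_(s < r) \sum_(j < M) F (s + j * r))%N.
Proof.
rewrite exchange_big/= mulnC; elim: M => [|M IHM]; first by rewrite mul0n !big_ord0.
rewrite big_ord_recr/= -IHM -(big_mkord xpredT F) mulSn addnC.
rewrite (big_cat_nat (n := (M * r)%N)) ?leq_addr//= big_mkord; congr addn.
rewrite -{1}(add0n (M * r)%N) big_addn addnC addnK big_mkord.
by apply: eq_bigr.
Qed.

(** * Most paths have many times at which the third point is poorly predicted *)

Section BadSteps.
Variables (G : groupType) (S : set G).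
Hypothesis hS : is_sym_fin_gen S.
Let K := (size (fset_set S)).+1.
Hypothesis K_gt1 : (1 < K)%N.
Variables (l e M' : nat).
Hypotheses (l_gt0 : (0 < l)%N) (e_gt0 : (0 < e)%N) (M'_gt1 : (1 < M')%N).
Let r := (l * e)%N.
Let M := (e * M')%N.
Variables (I : finType) (path : I -> nat -> G).
Hypothesis path0 : forall i, path i 0%N = 1%g.
Hypothesis path_step : forall i t k,
  (word_length S ((path i t)^-1 * path i (t + k)%N)%g <= k)%N.
Hypothesis path_end : forall t, (r * M <= t)%N -> injective (path ^~ t).
Variable bad : G -> G -> G -> bool.
Hypothesis not_bad : forall x y z z',
  ~~ bad x y z -> ~~ bad x y z' -> (word_length S (z^-1 * z')%g <= l)%N.

Definition bad_at i t : bool :=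
  bad (path i t) (path i (t + r)%N) (path i (t + r + r)%N).

(** The bound [M.-1] is the number of triples of consecutive points among s, s + r, ..., s + M r. *)
Definition few_bad s : pred I :=
  [pred i | (\sum_(j < M.-1) bad_at i (s + j * r) <= M')%N].

(** The possible positions [r] steps after [y], without the repetitions of [ball_seq], so that each
    one is weighted once. *)
Definition translated_ball (y : G) := [seq (y * b)%g | b <- undup (ball_seq S r)].

Lemma uniq_translated_ball y : uniq (translated_ball y).
Proof. by rewrite map_inj_uniq ?undup_uniq//; exact: mulgI. Qed.

Lemma size_translated_ball y : (size (translated_ball y) <= K ^ r)%N.
Proof. by rewrite size_map -size_ball_seq size_undup. Qed.

(** All good third points lie within [l] of any one of them, hence in a translate of the ball of
    radius [l]. *)
Lemma count_not_bad x y :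
  (count (fun z => ~~ bad x y z) (translated_ball y) <= K ^ l)%N.
Proof.
rewrite -size_filter; set s := [seq z <- _ | _].
have s_uniq : uniq s by rewrite filter_uniq ?uniq_translated_ball.
have sP z : z \in s -> ~~ bad x y z by rewrite mem_filter => /andP[].
case: s s_uniq sP => [//|z0 s] s_uniq sP.
rewrite -(size_ball_seq S) -(size_map (fun b => z0 * b)%g (ball_seq S l)).
apply: uniq_leq_size => // z /sP zP; apply/mapP; exists (z0^-1 * z)%g.
  by apply: mem_ball_seq => //; apply: not_bad zP; exact/sP/mem_head.
by rewrite mulVKg.
Qed.

(* Chernoff-type count: each bad step is given the weight K^-r, so that bad and
   good steps together leave only K^l + 1 weighted choices per step. *)
Lemma card_few_bad s :
  (s < r)%N -> (#|few_bad s| <= K ^ (4 * l * e * M'))%N.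
Proof.
move=> sr; pose k : rat := K%:R.
have k1 : 1 < k by rewrite ltr1n.
have k0 : 0 < k by exact: lt_trans k1.
pose th : rat := (k ^+ r)^-1.
have th0 : 0 < th by rewrite invr_gt0 exprn_gt0.
have th1 : th <= 1 by rewrite invf_le1 ?exprn_gt0// exprn_ege1// ltW.
pose w x y z : rat := if bad x y z then th else 1.
have w0 x y z : 0 <= w x y z by rewrite /w; case: ifP => // _; exact: ltW.
pose u t i := path i (s + t * r)%N.
have u_next t i : u t.+1 i \in translated_ball (u t i).
  apply/mapP; exists ((u t i)^-1 * u t.+1 i)%g; last by rewrite mulVKg.
  rewrite mem_undup; apply: mem_ball_seq => //.
  by rewrite /u mulSn addnCA (addnC r) path_step.
have rM0 : (0 < M)%N by rewrite muln_gt0 e_gt0 ltnW.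
have u_inj : injective (u M.-1.+1).
  by apply: path_end; rewrite prednK// mulnC leq_addl.
have w_sum x y : \sum_(z <- translated_ball y) w x y z <= k ^+ l + 1.
  rewrite (bigID (fun z => ~~ bad x y z))/=; apply: lerD.
    rewrite (eq_bigr (fun=> 1)); last by move=> z /negbTE zb; rewrite /w zb.
    by rewrite big_const_seq iter_addr_0 -natrX ler_nat count_not_bad.
  rewrite (eq_bigr (fun=> th)); last by move=> z /negbNE zb; rewrite /w zb.
  rewrite big_const_seq iter_addr_0 -[leLHS]mulr_natr ler_pdivrMl ?exprn_gt0// mulr1.
  by rewrite -natrX ler_nat (leq_trans (count_size _ _)) ?size_translated_ball.
have u0 i : u 0%N i \in ball_seq S r.
  apply: mem_ball_seq => //; rewrite /u mul0n addn0.
  have := path_step i 0 s; rewrite path0 invg1 mul1g add0n => /leq_trans; apply.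
  exact: ltnW.
have := path_weight_total u_next u_inj w0 w_sum u0 size_translated_ball.
rewrite size_ball_seq -/K => total.
(* Markov's inequality: a path with at most [M'] bad steps has weight at least [th ^+ M']. *)
have few : #|few_bad s|%:R * th ^+ M' <= \sum_i path_weight u w M.-1 0 i.
  rewrite [leRHS](bigID (few_bad s))/= -[leLHS]addr0.
  apply: lerD; last by apply: sumr_ge0 => i _; exact: path_weight_ge0.
  rewrite mulr_natl -sumr_const; apply: ler_sum => i; rewrite inE => /= fewi.
  have -> : path_weight u w M.-1 0 i =
      th ^+ (\sum_(j < M.-1) bad_at i (s + j * r)).
    rewrite /path_weight big_mkord expr_sum; apply: eq_bigr => j _.
    rewrite /w /bad_at /u !mulSn.
    have -> : (s + (r + j * r) = s + j * r + r)%N by lia.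
    have -> : (s + (r + (r + j * r)) = s + j * r + r + r)%N by lia.
    by case: ifP.
  by apply: ler_wiXn2l => //; exact: ltW.
have kl : k ^+ l + 1 <= k ^+ (2 * l).
  rewrite -!natrX natr1 ler_nat; apply: (@leq_trans (2 * K ^ l)).
    by rewrite mul2n -addnn -addn1 leq_add2l expn_gt0.
  rewrite [X in (_ <= _ ^ X)%N]mul2n -addnn expnD leq_mul2r orbC.
  by rewrite (leq_trans K_gt1)// -{1}(expn1 K) leq_exp2l.
(* The exponent collects r M' from the weight, r + r from the first two positions, and 2 l for each
   of the [M.-1] steps. *)
have : #|few_bad s|%:R <= k ^+ (r * M' + (r + r) + 2 * l * M.-1).
  rewrite !exprD [k ^+ (r * M')]exprM -mulrA mulrC -ler_pdivrMr ?exprn_gt0//.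
  rewrite -exprVn -/th (le_trans few)// (le_trans total)//.
  rewrite natrM !natrX -/k ler_wpM2l ?mulr_ge0 ?exprn_ge0 ?(ltW k0)//.
  by rewrite exprM lerXn2r ?nnegrE ?addr_ge0 ?exprn_ge0// ltW.
rewrite -natrX ler_nat => /leq_trans; apply.
rewrite leq_exp2l// /M /r.
(* As M' >= 2, the two initial terms [r] are absorbed by one more l e M'. *)
have : (l * e * 2 <= l * e * M')%N by rewrite leq_mul2l M'_gt1 orbT.
have : (2 * l * (e * M').-1 <= 2 * l * (e * M'))%N by rewrite leq_mul2l leq_pred orbT.
by nia.
Qed.

(** For each offset [s] at most half of the paths are in [few_bad s]; each of the others contributes
    more than [M'] bad times. Then sum over the [r] offsets. *)
Lemma many_bad : (2 * K ^ (4 * l * e * M') <= #|I|)%N ->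
  (#|I| * (r * M') <= 2 * \sum_i \sum_(t < r * M) bad_at i t)%N.
Proof.
move=> cI.
under [X in (_ <= 2 * X)%N]eq_bigr => i _ do
  rewrite (sum_nat_mul_grid r M (fun t => bad_at i t : nat)).
have -> : (#|I| * (r * M') = \sum_(s < r) #|I| * M')%N.
  by rewrite sum_nat_const card_ord mulnCA.
rewrite exchange_big/= big_distrr/=; apply: leq_sum => s _.
apply: (@leq_trans (2 * \sum_(i | ~~ few_bad s i) M')).
  have -> : (\sum_(i | ~~ few_bad s i) M' = (#|I| - #|few_bad s|) * M')%N.
    rewrite sum_nat_const -(cardC (few_bad s)) addKn; congr (_ * _)%N.
  have few := card_few_bad (ltn_ord s).
  rewrite mulnA leq_mul2r; apply/orP; right.
  move: cI few; move: (K ^ _)%N #|I| #|few_bad s| => a b1 b2 h1 h2; lia.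
rewrite leq_mul2l/=; rewrite [leqRHS](bigID (few_bad s))/=.
apply: leq_trans (leq_addl _ _); apply: leq_sum => i.
rewrite /few_bad/= -ltnNge => /ltnW/leq_trans; apply.
have M0 : (0 < M)%N by rewrite muln_gt0 e_gt0 ltnW.
have drop_last k (F : nat -> nat) : (0 < k)%N ->
    (\sum_(j < k.-1) F j <= \sum_(j < k) F j)%N.
  by case: k => // k _; rewrite big_ord_recr leq_addr.
exact: (drop_last M (fun j => bad_at i (s + j * r) : nat)).
Qed.

End BadSteps.

(** * Exponential growth and the bound on the dyadic sum *)

Lemma expr_unbounded (R : realType) (a x : R) : 1 < a -> exists k, x <= a ^+ (2 ^ k).
Proof.
move=> a1; have bern n : 1 + n%:R * (a - 1) <= a ^+ n.
  elim: n => [|n IHn]; first by rewrite mul0r addr0.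
  rewrite exprS -natr1; have a0 : 0 <= a by lra.
  have := ler_wpM2l a0 IHn.
  have : 0 <= n%:R * (a - 1) ^+ 2 by rewrite mulr_ge0 ?sqr_ge0.
  by rewrite expr2; lra.
have := archi_boundP (normr_ge0 (x / (a - 1))); set k := Num.bound _ => xk.
exists k; apply: le_trans (bern _).
have k2 : k%:R <= (2 ^ k)%:R :> R by rewrite ler_nat ltnW// ltn_expl.
have aB : 0 < a - 1 by rewrite subr_gt0.
have : x / (a - 1) <= (2 ^ k)%:R.
  by rewrite (le_trans (ler_norm _))// (le_trans (ltW xk)).
by rewrite ler_pdivrMr//; lra.
Qed.

Section DyadicSum.
Variables (R : realType) (G : groupType) (S : set G).
Hypothesis hS : is_sym_fin_gen S.
Hypothesis hgrowth : exponential_growth R S.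
Variables (V : zmodType) (N : V -> R) (q c : R).
Hypotheses (q_gt0 : 0 < q) (c_gt0 : 0 < c).
Hypothesis N_ge0 : forall x, 0 <= N x.
Hypothesis N_sub : forall x y, N (x - y) <= N x + N y.
Hypothesis N_mul2 : forall x, N (x *+ 2) = 2 * N x.
Hypothesis N_convex : forall x y,
  N x `^ q + c * N y `^ q <= (N (x + y) `^ q + N (x - y) `^ q) / 2.
Variables (psi : G -> V) (Lip : R).
Hypothesis psi_lip : forall g h,
  (word_length S (g^-1 * h)%g <= 1)%N -> N (psi h - psi g) <= Lip.
Variable gap : nat -> R.
Hypothesis gap_ge0 : forall i, 0 <= gap i.
Hypothesis gapP : forall i g h,
  (2 ^ i <= word_length S (g^-1 * h)%g)%N -> gap i <= N (psi h - psi g).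

Let K := (size (fset_set S)).+1.

Lemma card_word_ball_le n : (#|` fset_set (word_ball S n)| <= K ^ n)%N.
Proof.
rewrite -size_ball_seq; apply: uniq_leq_size; first exact: fset_uniq.
move=> g; rewrite in_fset_set; last exact: finite_word_ball.
by rewrite inE; exact: mem_ball_seq.
Qed.

Lemma growth_gens_gt1 : (1 < K)%N.
Proof.
have [a a1 /(_ 1%N)] := hgrowth; rewrite expr1 => aB.
rewrite -(ltr_nat R) (lt_le_trans a1)// (le_trans aB)// ler_nat.
by rewrite (leq_trans (card_word_ball_le 1)) ?expn1.
Qed.

(** [many_bad] with l = 2^i, e = 2^j, M' = 2^(m-i+1). The horizon l e^2 M' = 2^(m+2j+1) is then the
    same for every scale [i], and the proportion of bad times does not depend on [i] either. *)
Lemma scale_bending (j m i : nat) (I : finType) (path : I -> nat -> G) :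
    (i < m)%N -> (2 * K ^ (4 * 2 ^ i * 2 ^ j * 2 ^ (m - i).+1) <= #|I|)%N ->
    (forall x, path x 0%N = 1%g) ->
    (forall x t k,
      (word_length S ((path x t)^-1 * path x (t + k)%N)%g <= k)%N) ->
    (forall t, (2 ^ (m + j + j).+1 <= t)%N -> injective (path ^~ t)) ->
  #|I|%:R * (2 ^ (m + j + j).+1)%:R / 2 ^+ j.+1 * (gap i / 2) `^ q <=
  \sum_x bending N q (psi \o path x) (2 ^ (m + j + j).+1) (2 ^ (i + j)).
Proof.
move=> im cI path0 path_step path_end.
set n := (2 ^ _)%N in path_end *.
have nE : n = (2 ^ i * 2 ^ j * (2 ^ j * 2 ^ (m - i).+1))%N.
  by rewrite /n -!expnD; congr expn; lia.
pose defect x y z := psi z - psi y - (psi y - psi x).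
pose bad x y z := gap i <= 2 * N (defect x y z).
have not_bad x y z z' : ~~ bad x y z -> ~~ bad x y z' ->
    (word_length S (z^-1 * z')%g <= 2 ^ i)%N.
  rewrite /bad -!ltNge => zb z'b; rewrite leqNgt; apply/negP => /ltnW/gapP.
  (* Two good third points have images closer than [gap i], as the prediction from [x] and [y]
     cancels; by [gapP] they are then close in the group. *)
  have -> : psi z' - psi z = defect x y z' - defect x y z.
    have subBB (u v b : V) : u - b - (v - b) = u - v by rewrite opprB addrA subrK.
    by rewrite /defect !subBB.
  by have := N_sub (defect x y z') (defect x y z); lra.
have M'_gt1 : (1 < 2 ^ (m - i).+1)%N by rewrite -{1}(expn0 2) ltn_exp2l.
have := @many_bad G S hS growth_gens_gt1 (2 ^ i) (2 ^ j) (2 ^ (m - i).+1)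
  (expn_gt0 _ _) (expn_gt0 _ _) M'_gt1 I path path0 path_step.
rewrite -nE => /(_ path_end bad not_bad cI).
rewrite -expnD; set r := (2 ^ (i + j))%N; set B := (\sum_x _)%N => bads.
apply: (@le_trans _ _ (B%:R * (gap i / 2) `^ q)).
  rewrite ler_wpM2r ?powR_ge0// ler_pdivrMr ?exprn_gt0//.
  move: bads; rewrite -(ler_nat R) => bads.
  have -> : n%:R = (r * 2 ^ (m - i).+1)%:R * 2 ^+ j :> R.
    by rewrite -natrX -natrM /r nE; congr (_%:R); rewrite expnD; lia.
  rewrite mulrA -natrM exprS mulrA ler_wpM2r ?exprn_ge0//.
  by rewrite -natrM (mulnC B).
rewrite natr_sum mulr_suml; apply: ler_sum => x _.
rewrite natr_sum mulr_suml; apply: ler_sum => t _.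
rewrite /bad_at -expnD -/r; case: (boolP (bad _ _ _)) => [|_]; last first.
  by rewrite mul0r powR_ge0.
rewrite mul1r /bad => gapt; apply: ge0_ler_powR; rewrite ?nnegrE ?(ltW q_gt0)//.
  by rewrite divr_ge0.
by rewrite ler_pdivrMr// mulrC.
Qed.

(** The bending of geodesics to all points of a ball of radius [n] is bounded above by convexity and
    below by [scale_bending]. Both bounds are proportional to #|I| n, which cancels. *)
Lemma dyadic_gap_sum_bounded :
  exists C, forall m, \sum_(i < m) (gap i / (2 ^ i)%:R) `^ q <= C.
Proof.
have [a a1 growth] := hgrowth.
(* With n = 2^j s this gives a^n >= K^(5s) >= 2 K^(4s): the fifth power pays for the factor 2
   required by [many_bad]. *)
have [j Kj] := expr_unbounded (K%:R ^+ 5) a1.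
(* 2^(j+1) is the inverse proportion of bad times; 2^(j+2) comes from the half in [gap i / 2] and
   from normalising scale i + j by 2^(i+j+1). *)
exists (2 ^+ j.+1 * (2 ^ j.+2)%:R `^ q * Lip `^ q / c) => m.
pose n := (2 ^ (m + j + j).+1)%N.
pose I : finType := fset_set (word_ball S n).
have cardI : a ^+ n <= #|I|%:R by rewrite -cardfE growth.
have lenI (x : I) : (word_length S (val x) <= n)%N.
  have := valP x; rewrite in_fset_set; last exact: finite_word_ball.
  by rewrite inE.
have [path pathP] := choice (fun x : I => word_path hS (lenI x)).
have path0 x : path x 0%N = 1%g by have [] := pathP x.
have path_n x t : (n <= t)%N -> path x t = val x.
  by have [_ + _] := pathP x; apply.
have path_step x t k :
    (word_length S ((path x t)^-1 * path x (t + k)%N)%g <= k)%N.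
  by have [_ _] := pathP x; apply.
have path_end t : (n <= t)%N -> injective (path ^~ t).
  by move=> nt x y; rewrite !path_n//; exact: val_inj.
have I_gt0 : 0 < #|I|%:R :> R.
  by apply: lt_le_trans cardI; rewrite exprn_gt0// (lt_trans ltr01).
have n_gt0 : 0 < n%:R :> R by rewrite ltr0n expn_gt0.
have bigI i : (i < m)%N ->
    (2 * K ^ (4 * 2 ^ i * 2 ^ j * 2 ^ (m - i).+1) <= #|I|)%N.
  move=> im; rewrite -(ler_nat R); apply: le_trans cardI.
  pose s := (2 ^ i * 2 ^ j * 2 ^ (m - i).+1)%N.
  have -> : n = (2 ^ j * s)%N by rewrite /n /s -!expnD; congr expn; lia.
  have -> : (4 * 2 ^ i * 2 ^ j * 2 ^ (m - i).+1 = 4 * s)%N by rewrite /s !mulnA.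
  rewrite exprM; apply: (@le_trans _ _ ((K%:R ^+ 5) ^+ s)); last first.
    by rewrite lerXn2r ?nnegrE ?exprn_ge0//; lra.
  rewrite -exprM -natrX ler_nat (mulSn 4) expnD leq_mul2r orbC.
  rewrite (leq_trans growth_gens_gt1)// -{1}(expn1 K) leq_exp2l ?growth_gens_gt1//.
  by rewrite !muln_gt0 !expn_gt0.
have upper : c * \sum_(k < m + j) (\sum_x bending N q (psi \o path x) n (2 ^ k)) /
    (2 ^ k.+1)%:R `^ q <= #|I|%:R * (n%:R * Lip `^ q).
  rewrite [leRHS]mulr_natl -sumr_const.
  under eq_bigr do rewrite mulr_suml.
  rewrite exchange_big/= mulr_sumr; apply: ler_sum => x _.
  apply: le_trans (dyadic_bending_le _ _ _ _ _ _) _ => //.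
    by move=> t nt /=; rewrite !path_n.
  rewrite [leRHS]mulr_natl -[X in _ *+ X]card_ord -sumr_const.
  apply: ler_sum => t _ /=; apply: ge0_ler_powR; rewrite ?nnegrE ?(ltW q_gt0)//.
    (* Nonnegativity of [Lip] is read off from a trivial increment. *)
    apply: le_trans (psi_lip (g := 1%g) (h := 1%g) _) => //.
    by rewrite mulVg word_length1.
  exact/psi_lip/path_step.
have lower : \sum_(i < m) #|I|%:R * n%:R / 2 ^+ j.+1 * (gap i / 2) `^ q /
      (2 ^ (i + j).+1)%:R `^ q <=
    \sum_(k < m + j) (\sum_x bending N q (psi \o path x) n (2 ^ k)) /
      (2 ^ k.+1)%:R `^ q.
  pose F k := (\sum_x bending N q (psi \o path x) n (2 ^ k)) / (2 ^ k.+1)%:R `^ q.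
  have F0 k : 0 <= F k.
    rewrite divr_ge0 ?powR_ge0// sumr_ge0// => x _.
    by rewrite sumr_ge0// => t _; exact: powR_ge0.
  (* The gap at scale [i] is seen in second differences at scale i + j; the first [j] scales are
     dropped. *)
  rewrite -(big_mkord xpredT F) (big_cat_nat (n := j)) ?leq_addl//=.
  rewrite -[leLHS]add0r; apply: lerD; first exact: sumr_ge0.
  have -> : \sum_(j <= k < m + j) F k = \sum_(i < m) F (i + j)%N.
    by rewrite -{1}(add0n j) big_addn addnK big_mkord.
  apply: ler_sum => i _.
  by rewrite /F ler_wpM2r ?invr_ge0 ?powR_ge0// scale_bending ?bigI.
have := le_trans (ler_wpM2l (ltW c_gt0) lower) upper.
have -> : \sum_(i < m) #|I|%:R * n%:R / 2 ^+ j.+1 * (gap i / 2) `^ q /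
      (2 ^ (i + j).+1)%:R `^ q =
    #|I|%:R * n%:R / 2 ^+ j.+1 / (2 ^ j.+2)%:R `^ q *
    \sum_(i < m) (gap i / (2 ^ i)%:R) `^ q :> R.
  rewrite mulr_sumr; apply: eq_bigr => i _.
  have pow0 k : (2 ^ k)%:R `^ q != 0 :> R.
    by rewrite gt_eqF// powR_gt0// ltr0n expn_gt0.
  have swap : (gap i / 2) `^ q * (2 ^ j.+2)%:R `^ q =
      (gap i / (2 ^ i)%:R) `^ q * (2 ^ (i + j).+1)%:R `^ q.
    rewrite -!powRM ?divr_ge0//; congr (_ `^ q).
    rewrite -addnS expnD expnS !natrM; field.
    by rewrite pnatr_eq0 expn_eq0.
  rewrite -[LHS]mulrA -[RHS]mulrA; congr (_ * _); apply/eqP.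
  by rewrite [X in _ == X]mulrC eqr_div ?pow0// swap.
set s := \sum_(i < m) _; set P := _ `^ q; set Q := Lip `^ q.
have P0 : 0 < P by rewrite powR_gt0// ltr0n expn_gt0.
have T0 : 0 < 2 ^+ j.+1 :> R by rewrite exprn_gt0.
move: I_gt0 n_gt0; set x := #|I|%:R; set y := n%:R => x0 y0 h.
rewrite ler_pdivlMr//.
have TP0 : 0 <= 2 ^+ j.+1 * P / (x * y) by rewrite divr_ge0 ?mulr_ge0// ltW.
have := ler_wpM2r TP0 h; congr (_ <= _); field.
  by rewrite !gt_eqF.
by rewrite !gt_eqF.
Qed.

End DyadicSum.

(** * From the dyadic sum to the integral *)

Lemma integral_powR_dyadic (R : realType) (f : R -> R) (q C : R) : 0 < q ->
    nondecreasing_fun f -> (forall t, 0 <= f t) ->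
    (forall k, \sum_(i < k) (f (2 ^ i)%:R / (2 ^ i)%:R) `^ q <= C) ->
  (\int[lebesgue_measure]_(t in `[1%R, +oo[) ((f t / t) `^ q / t)%:E < +oo)%E.
Proof.
move=> q0 f_nd f_ge0 fC.
pose F k : set R := `[(2 ^ k)%:R, (2 ^ k.+1)%:R[%classic.
have pow_lt k : (2 ^ k)%:R < (2 ^ k.+1)%:R :> R by rewrite ltr_nat ltn_exp2l.
have pow_gt0 k : 0 < (2 ^ k)%:R :> R by rewrite ltr0n expn_gt0.
have FE : `[1%R, +oo[%classic = \bigcup_k F k.
  apply/seteqP; split => t /=; rewrite in_itv/= ?andbT.
    move=> t1; have t0 : 0 <= t by exact: le_trans t1.
    have tb : exists k, t < (2 ^ k)%:R.
      exists (Num.bound t); apply: (lt_le_trans (archi_boundP t0)).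
      by rewrite ler_nat ltnW// ltn_expl.
    have /ex_minnP[k tk kmin] := tb; case: k tk kmin => [|k] tk kmin.
      by move: tk; rewrite expn0 ltNge t1.
    exists k => //; rewrite /F/= in_itv/= tk andbT leNgt; apply/negP => /kmin.
    by rewrite ltnn.
  move=> [k _]; rewrite /F/= in_itv/= => /andP[+ _]; apply: le_trans.
  by rewrite ler1n expn_gt0.
have F_triv : trivIset setT F.
  suff F_disj i j t : (i < j)%N -> F i t -> F j t -> False.
    move=> i j _ _ [t [Fi Fj]]; case: (ltngtP i j) => // ij; exfalso.
      exact: F_disj ij Fi Fj.
    exact: F_disj ij Fj Fi.
  move=> ij; rewrite /F/= !in_itv/= => /andP[_ ti] /andP[tj _].
  by have := le_lt_trans tj ti; rewrite ltr_nat ltn_exp2l// ltnS leqNgt ij.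
have fq_ge0 t : 1 <= t -> 0 <= (f t / t) `^ q / t.
  by move=> t1; rewrite divr_ge0 ?powR_ge0// (le_trans _ t1).
pose D : set R := `[1%R, +oo[%classic.
have mD : measurable D by exact: measurable_itv.
have mf : measurable_fun D (fun t => (f t / t) `^ q / t).
  have minv : measurable_fun D (fun t : R => t^-1).
    (* On [D] the inverse agrees with a function that is monotone on the whole line, hence
       measurable. *)
    apply: (eq_measurable_fun (fun t : R => (Num.max 1 t)^-1)).
      by move=> t; rewrite inE/D/= in_itv/= andbT => /max_idPr ->.
    apply: nonincreasing_measurable => // s t st.
    rewrite lef_pV2 ?posrE ?lt_max ?ltr01//.
    by rewrite ge_max !le_max lexx st orbT.
  apply: measurable_funM => //.
  apply: (@measurableT_comp _ _ _ _ _ _ (@powR R ^~ q)) => //.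
  by apply: measurable_funM => //; exact: nondecreasing_measurable.
rewrite FE ge0_integral_bigcup//; last first.
- by rewrite -FE => t /=; rewrite in_itv/= andbT lee_fin; exact: fq_ge0.
- by rewrite -FE -/D; exact/measurable_EFinP.
- by move=> k; exact: measurable_itv.
have F_sub k : F k `<=` D.
  by rewrite /D FE => t Fkt; exists k.
(* On [2^k, 2^(k+1)[ one has f t <= f (2^(k+1)) and 1/t <= 2^(-k), and the block has length 2^k. *)
have F_le k : (\int[lebesgue_measure]_(t in F k) ((f t / t) `^ q / t)%:E <=
    (2 `^ q * (f (2 ^ k.+1)%:R / (2 ^ k.+1)%:R) `^ q)%:E)%E.
  set u := 2 `^ q * _.
  apply: (@le_trans _ _ (\int[lebesgue_measure]_(t in F k)
      (cst (u / (2 ^ k)%:R)%:E t))%E).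
    apply: ge0_le_integral => //.
    - exact: measurable_itv.
    - move=> t /F_sub; rewrite /D/= in_itv/= andbT lee_fin; exact: fq_ge0.
    - by apply/measurable_EFinP; exact: measurable_funS mD (F_sub k) mf.
    move=> t; rewrite /F/= in_itv/= lee_fin => /andP[kt tk].
    have t0 : 0 < t by apply: lt_le_trans kt.
    apply: ler_pM; rewrite ?powR_ge0 ?invr_ge0 ?(ltW t0)//; last first.
      by rewrite lef_pV2 ?posrE.
    rewrite /u -powRM//; last by rewrite divr_ge0// ltW.
    apply: ge0_ler_powR; rewrite ?nnegrE ?(ltW q0)//.
    - by rewrite divr_ge0// ltW.
    - by rewrite mulr_ge0// divr_ge0// ltW.
    have -> : 2 * (f (2 ^ k.+1)%:R / (2 ^ k.+1)%:R) = f (2 ^ k.+1)%:R / (2 ^ k)%:R.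
      by rewrite [in X in _ / X]expnS natrM; field; rewrite gt_eqF.
    apply: ler_pM; rewrite ?invr_ge0 ?(ltW t0)//; last by rewrite lef_pV2 ?posrE.
    exact/f_nd/ltW.
  rewrite integral_cst; last exact: measurable_itv.
  have mFk : lebesgue_measure (F k) = (2 ^ k)%:R%:E.
    have := lebesgue_measure_itv `[(2 ^ k)%:R : R, (2 ^ k.+1)%:R[.
    rewrite /= lte_fin pow_lt => ->; rewrite -EFinB; congr _%:E.
    by rewrite expnS natrM; ring.
  rewrite [X in (_ * X <= _)%E]mFk -EFinM lee_fin.
  by rewrite divfK// gt_eqF.
apply: (@le_lt_trans _ _ (2 `^ q * C)%:E); last exact: ltry.
apply: lime_le.
  apply: is_cvg_nneseries => k _ _; apply: integral_ge0 => t /F_sub.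
  by rewrite /D/= in_itv/= andbT lee_fin; exact: fq_ge0.
near=> k; apply: (@le_trans _ _ (\sum_(0 <= i < k)
    (2 `^ q * (f (2 ^ i.+1)%:R / (2 ^ i.+1)%:R) `^ q)%:E)%E).
  by apply: lee_sum => i _; exact: F_le.
rewrite sumEFin lee_fin -mulr_sumr ler_wpM2l ?powR_ge0//.
(* The blocks use right endpoints, so the sum starts at index 1 and the term of index 0 is added. *)
apply: le_trans (fC k.+1); rewrite big_ord_recl/= big_mkord.
by rewrite lerDr powR_ge0.
Unshelve. all: by end_near. Qed.

(** Otherwise the balls would stop growing. This makes the infimum defining the compression range
    over a non-empty set. *)
Lemma word_length_unbounded (R : realType) (G : groupType) (S : set G) (n : nat) :
  is_sym_fin_gen S -> exponential_growth R S ->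
  exists g, (n <= word_length S g)%N.
Proof.
move=> hS [a a1 growth]; apply: contrapT => /forallNP bounded.
have ballE k : (n <= k)%N -> word_ball S k = word_ball S n.
  move=> nk; apply/seteqP; split => g _ /=; rewrite /word_ball/=;
    by have /negP := bounded g; rewrite -ltnNge => /ltnW // /leq_trans; apply.
have [j aj] := expr_unbounded (#|` fset_set (word_ball S n)|%:R + 1) a1.
have a0 : 0 < a by exact: lt_trans a1.
have := growth (2 ^ j + n)%N; rewrite ballE ?leq_addl//.
apply/negP; rewrite -ltNge (@lt_le_trans _ _ (a ^+ (2 ^ j)))//.
  by apply: lt_le_trans aj; rewrite ltrDl.
by rewrite ler_weXn2l ?(ltW a1)// leq_addr.
Qed.

(** * Elementary properties of compression and uniform embeddings *)

Section Compression.
Variables (R : realType) (X Y : Type) (dX : X -> X -> R) (dY : Y -> Y -> R).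
Variable F : X -> Y.
Hypothesis dY_ge0 : forall x y, 0 <= dY x y.
Hypothesis dX_unbounded : forall t, exists x y, t <= dX x y.

Let has_lb t :
  has_lbound [set dY (F z.1) (F z.2) | z in [set z : X * X | t <= dX z.1 z.2]].
Proof. by exists 0 => _ [z _ <-]. Qed.

Lemma compression_le x y t : t <= dX x y -> compression dX dY F t <= dY (F x) (F y).
Proof. by move=> txy; apply: ge_inf => //; exists (x, y). Qed.

Let dist_set0 t :
  [set dY (F z.1) (F z.2) | z in [set z : X * X | t <= dX z.1 z.2]] !=set0.
Proof.
by have [x [y txy]] := dX_unbounded t; exists (dY (F x) (F y)), (x, y).
Qed.

Lemma compression_ge0 t : 0 <= compression dX dY F t.
Proof. by apply: lb_le_inf => // _ [z _ <-]. Qed.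

(** Unboundedness of [dX] matters here: the infimum of an empty set is 0 by convention. *)
Lemma compression_nondecreasing : nondecreasing_fun (compression dX dY F).
Proof.
move=> s t st; apply: lb_le_inf => // _ [[x y] /= txy <-].
by apply: compression_le; exact: le_trans txy.
Qed.

(** Otherwise some pairs at distance at most [b] have images at distance tending to infinity, so the
    pairs themselves would drift apart. *)
Lemma uniform_embedding_bounded (b : R) : uniform_embedding dX dY F ->
  exists c, forall x y, dX x y <= b -> dY (F x) (F y) <= c.
Proof.
move=> unif; apply: contrapT => /forallNP unbounded.
have far n : exists z : X * X, dX z.1 z.2 <= b /\ n%:R <= dY (F z.1) (F z.2).
  have /existsNP[x /existsNP[y /not_implyP[xy /negP]]] := unbounded n%:R.
  by rewrite -ltNge => /ltW nxy; exists (x, y).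
have [z zP] := choice far.
have : dY (F (z n).1) (F (z n).2) @[n --> \oo] --> +oo.
  apply/cvgryPge => A; near=> n; apply: le_trans (zP n).2.
  near: n; exact: nbhs_infty_ger.
move=> /(unif (fun n => (z n).1) (fun n => (z n).2)) /cvgryPge/(_ (b + 1)).
move=> [n _ /(_ n (leqnn n))] /= far_n.
by have := le_trans far_n (zP n).1; rewrite gerDl ler10.
Unshelve. all: by end_near. Qed.

End Compression.

Section LspaceTypeNorm.
Variables (R : realType) (d : measure_display) (X : measurableType d).
Variables (m : {measure set X -> \bar R}) (p : R) (p1 : (1 <= p%:E)%E).

Lemma Lspace_mem_Lfun (f : LspaceType m p1) : (f : X -> R) \in Lfun m p%:E.
Proof.
rewrite inE; apply/andP; split; rewrite inE.
  exact: (measurable_funPT (repr (f : {mfun_ m, X >-> measurableTypeR R}))).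
exact: Lebesgue_finite.
Qed.

(** The convexity argument runs in the additive group of functions with the seminorm [Lp_norm], so
    each class is replaced by its representative. *)
Definition Lfun_of_Lspace (f : LspaceType m p1) : LfunType m p1 :=
  Lfun_Sub p1 (Lspace_mem_Lfun f).

Lemma Lp_distE (f g : LspaceType m p1) :
  Lp_dist f g = Lp_norm (Lfun_of_Lspace f - Lfun_of_Lspace g).
Proof. by []. Qed.

End LspaceTypeNorm.

Theorem corollary6 (R : realType) (G : groupType) (S : set G)
    (hS : is_sym_fin_gen S)
    (hgrowth : exponential_growth R S)
    (hG : virtually_solvable G \/ ~ amenable G R)
    (p : R) (p1 : (1 < p%:E)%E)
    (d : measure_display) (X : measurableType d)
    (m : {measure set X -> \bar R})
    (phi : G -> LspaceType m (ltW p1))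
    (hphi : uniform_embedding (@word_metric G R S)
                              (@Lp_dist R d X m p%:E (ltW p1)) phi) :
  let q := Num.max p 2 in
  let rho := compression (@word_metric G R S)
                         (@Lp_dist R d X m p%:E (ltW p1)) phi in
  (\int[lebesgue_measure]_(t in `[1%R, +oo[) ((rho t / t) `^ q / t)%:E < +oo)%E.
Proof.
cbv zeta; set q := Num.max p 2; set rho := compression _ _ _.
have p1' : 1 < p by rewrite -lte_fin.
have q0 : 0 < q by rewrite lt_max ltr0n orbT.
pose psi g := Lfun_of_Lspace (phi g).
have dist_ge0 f g : 0 <= @Lp_dist R d X m p%:E (ltW p1) f g.
  by rewrite Lp_distE Lp_norm_ge0.
have wl_unbounded t : exists g h, t <= @word_metric G R S g h.
  have [g ng] := word_length_unbounded (Num.bound `|t|) hS hgrowth.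
  exists 1%g, g; rewrite /word_metric invg1 mul1g (le_trans (ler_norm t))//.
  by rewrite (le_trans (ltW (archi_boundP (normr_ge0 t))))// ler_nat.
have rho_ge0 t : 0 <= rho t by exact: compression_ge0.
(* A bound on the images of pairs at distance at most 1 controls the single steps of every path. *)
have [Lip LipP] := uniform_embedding_bounded 1 hphi.
have normC f g : Lp_norm (psi g - psi f) = Lp_norm (psi f - psi g).
  by rewrite -opprB; exact: LnormrN.
have psi_lip g h : (word_length S (g^-1 * h)%g <= 1)%N ->
    Lp_norm (psi h - psi g) <= Lip.
  by move=> gh; rewrite normC -Lp_distE; apply: LipP; rewrite /word_metric lern1.
have gapP i g h : (2 ^ i <= word_length S (g^-1 * h)%g)%N ->
    rho (2 ^ i)%:R <= Lp_norm (psi h - psi g).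
  move=> gh; rewrite normC -Lp_distE.
  by apply: compression_le => //; rewrite /word_metric ler_nat.
have [C CP] := @dyadic_gap_sum_bounded R G S hS hgrowth _ _ q _ q0
  (convexity_const_gt0 p1') (@Lp_norm_ge0 _ _ _ _ _ _) (@Lp_normB _ _ _ _ _ _)
  (@Lp_norm2 _ _ _ _ _ _) (fun f g => Lp_norm_convex f g p1') psi Lip psi_lip
  (fun i => rho (2 ^ i)%:R) (fun i => rho_ge0 _) gapP.
apply: (integral_powR_dyadic q0 _ rho_ge0 CP).
exact: compression_nondecreasing.
Qed.
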